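(* Let $\Gamma$ be a metrized graph with vertex set $V(\Gamma)$ and edge set $E(\Gamma)$, with voltage function $j_z(x,y)$ and resistance function $r(x,y)$. Let $e_i \in E(\Gamma)$ be an edge of length $L_i$ with end points $p_i$ and $q_i$, and let $e_j \in E(\Gamma)$ be an edge of length $L_j$ with end points $p_j$ and $q_j$. Suppose the edges $e_i$ and $e_j$ are distinct, but their end points are not necessarily distinct. If $x$ belongs to the edge $e_i$ and $y$ belongs to the edge $e_j$, then $$\begin{aligned} r(x,y) &= -x^2\, \frac{L_i - r(p_i,q_i)}{L_i^2}-y^2\, \frac{L_j - r(p_j,q_j)}{L_j^2} +\frac{2xy}{L_i L_j} \big(j_{p_j}(p_i,q_j)-j_{p_j}(q_i,q_j)\big)\\ & \qquad +\frac{x}{L_i} \big(L_i-2j_{p_i}(q_i,p_j)\big) +\frac{y}{L_j} \big(L_j-2j_{p_j}(p_i,q_j)\big) +r(p_i,p_j), \end{aligned}$$ where on the right-hand side $x\in[0,L_i]$ and $y\in[0,L_j]$ denote the parameters of the points $x\in e_i$ and $y\in e_j$.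
   Context: A metrized graph $\Gamma$ is a finite connected graph whose edges are equipped with a distinguished parametrization by line segments (multiple edges and self-loops are allowed). The valence of $p\in\Gamma$ is the number of directions emanating from $p$. A vertex set $V(\Gamma)$ is a finite non-empty subset of $\Gamma$ containing every point of valence $\neq 2$ (additional points of valence 2 may be included). The set $E(\Gamma)$ of edges is the set of closed line segments with end points in $V(\Gamma)$ into which $V(\Gamma)$ divides $\Gamma$; the length of $e_i$ is a positive real number $L_i$. Parametrization convention: an edge $e_i$ of length $L_i$ with end points $p_i,q_i$ is identified with $[0,L_i]$ so that $p_i$ corresponds to $0$ and $q_i$ to $L_i$ (likewise for $e_j$). A point of an edge and the corresponding real number are denoted by the same letter: in the arguments of $r$ and $j$ the letters denote points of $\Gamma$, elsewhere in formulas they denote the real parameters. Voltage and resistance functions: view $\Gamma$ as a resistive electric circuit in which each edge has resistance equal to its length. For $x,y,z\in\Gamma$, $j_z(x,y)$ is the voltage difference between $x$ and $z$ when unit current enters at $y$ and exits at $z$ (with reference voltage $0$ at $z$). Equivalently, for fixed $y,z$, $x\mapsto j_z(x,y)$ is the unique continuous piecewise affine function $f$ on $\Gamma$ with $f(z)=0$ and $\Delta f=\delta_y-\delta_z$, where $\Delta f=-\sum_{p}\sigma_p(f)\,\delta_p$ and $\sigma_p(f)$ is the sum of the slopes of $f$ in all directions emanating from $p$. The resistance function is $r(x,y)=j_y(x,x)$, the effective resistance between $x$ and $y$. *)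

(* Defs.v *)
From HB Require Import structures.
From mathcomp Require Import all_boot all_order all_algebra.
From mathcomp Require Import all_classical all_reals all_analysis.

Set Implicit Arguments.
Unset Strict Implicit.
Unset Printing Implicit Defensive.

Import Order.TTheory GRing.Theory Num.Theory.
Import numFieldNormedType.Exports.
Local Open Scope classical_set_scope.
Local Open Scope ring_scope.

(* A metrized graph together with a vertex set.  The edge e is a copy of
   [0, len e] whose parameters 0 and len e are glued to src e and tgt e;
   self-loops (src e = tgt e) and multiple edges are allowed.  Points of
   valence different from 2 are vertices by construction. *)
Record metrized_graph (R : realType) := MetrizedGraph {
  vert : finType;
  edge : finType;
  src : edge -> vert;
  tgt : edge -> vert;
  len : edge -> R;
  len_gt0 : forall e : edge, 0 < len e;
  vert_nonempty : (0 < #|vert|)%N;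
  vert_connected : forall u v : vert,
    connect (fun a b : vert =>
      [exists e : edge, ((src e == a) && (tgt e == b))
                     || ((src e == b) && (tgt e == a))]) u v
}.

(* A pair (edge, parameter) with the parameter strictly between the ends. *)
Definition interior_point (R : realType) (G : metrized_graph R) : Type :=
  {et : edge G * R | 0 < et.2 < len et.1}.

(* Every point of the graph is represented exactly once: either it is a vertex
   or it lies in the relative interior of a unique edge. *)
Definition mg_point (R : realType) (G : metrized_graph R) : Type :=
  (vert G + interior_point G)%type.

(* The point of the closed edge e with parameter t; meaningful for t in
   [0, len e], and clamped to the nearest end point otherwise. *)
Definition edge_point (R : realType) (G : metrized_graph R)
    (e : edge G) (t : R) : mg_point G :=
  if insub (e, t) is Some p then inr (p : interior_point G)
  else inl (if t <= 0 then src e else tgt e).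

(* f is continuous in the quotient topology iff it is continuous in the
   parameter along each closed edge.  Affineness is only required on the open
   pieces cut out by a finite list s of break points. *)
Definition continuous_piecewise_affine (R : realType) (G : metrized_graph R)
    (f : mg_point G -> R) : Prop :=
  forall e : edge G,
    {within `[0, len e], continuous (fun t : R => f (edge_point e t))} /\
    exists s : seq R, forall a b : R,
      0 <= a -> a < b -> b <= len e ->
      (forall t : R, t \in s -> ~~ (a < t < b)) ->
      exists m c : R, forall t : R, a < t < b ->
        f (edge_point e t) = m * t + c.

(* One-sided slopes of f at the parameter t of the edge e, in the directions of
   increasing and of decreasing parameter. *)
Definition slope_fwd (R : realType) (G : metrized_graph R)
    (f : mg_point G -> R) (e : edge G) (t : R) : R :=
  lim ((f (edge_point e (t + h)) - f (edge_point e t)) / h @[h --> 0^'+]).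

Definition slope_bwd (R : realType) (G : metrized_graph R)
    (f : mg_point G -> R) (e : edge G) (t : R) : R :=
  lim ((f (edge_point e (t - h)) - f (edge_point e t)) / h @[h --> 0^'+]).

(* Sum of the slopes of f over all directions emanating from p; a self-loop at
   a vertex contributes one term to each of the two sums. *)
Definition slope_sum (R : realType) (G : metrized_graph R)
    (f : mg_point G -> R) (p : mg_point G) : R :=
  match p with
  | inl v => \sum_(e : edge G | src e == v) slope_fwd f e 0
           + \sum_(e : edge G | tgt e == v) slope_bwd f e (len e)
  | inr q => slope_fwd f (val q).1 (val q).2 + slope_bwd f (val q).1 (val q).2
  end.

(* The mass at p of the discrete measure Delta f. *)
Definition laplacian (R : realType) (G : metrized_graph R)
    (f : mg_point G -> R) (p : mg_point G) : R := - slope_sum f p.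

(* f is the potential when unit current enters at y and exits at z, with
   reference voltage 0 at z.  An equality of discrete measures is stated as
   equality of the masses at all points. *)
Definition is_voltage (R : realType) (G : metrized_graph R)
    (z y : mg_point G) (f : mg_point G -> R) : Prop :=
  [/\ continuous_piecewise_affine f,
      f z = 0
    & forall p : mg_point G, laplacian f p = (p == y)%:R - (p == z)%:R].

(* voltage z x y is j_z(x, y); the default value of xget is irrelevant since
   the potential exists and is unique. *)
Definition voltage (R : realType) (G : metrized_graph R)
    (z x y : mg_point G) : R :=
  xget (fun _ : mg_point G => 0) [set f | is_voltage z y f] x.

Definition resistance (R : realType) (G : metrized_graph R)
    (x y : mg_point G) : R := voltage y x x.

(* Main.v *)
Require Import Defs.
From HB Require Import structures.
From mathcomp Require Import all_boot all_order all_algebra.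
From mathcomp Require Import all_classical all_reals all_analysis.
From mathcomp Require Import ring lra.

Import Order.TTheory GRing.Theory Num.Theory.
Import numFieldNormedType.Exports.
Local Open Scope ring_scope.

(* Replace a point x of the edge e_i by the measure (1 - x/L_i) delta_{p_i} +
   (x/L_i) delta_{q_i} on its end points.  The two charges differ by the
   Laplacian of a tent function supported in e_i, whose value at x is
   x(L_i - x)/L_i; since e_i and e_j are distinct, the tents of x and y do not
   interact.  Hence r(x,y) is x(L_i - x)/L_i + y(L_j - y)/L_j plus the energy
   of a charge on the four end points, which is a bilinear expression in the
   Green function of the weighted vertex Laplacian.  Every voltage is a
   difference of values of the same Green function, so the formula becomes a
   polynomial identity. *)

(** * Piecewise affine functions and their slopes *)

Definition affine_between {R : realType} (a b : R) (F : R -> R) : Prop :=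
  exists m c : R, forall t : R, a <= t <= b -> F t = m * t + c.

Definition affine_off {R : realType} (L : R) (s : seq R) (F : R -> R) : Prop :=
  forall a b : R, 0 <= a -> a < b -> b <= L ->
    (forall t : R, t \in s -> ~~ (a < t < b)) -> affine_between a b F.

(** At each end point, one-sided continuity and uniqueness of limits force the affine formula. The
    open pieces of [continuous_piecewise_affine] thus become closed ones, on which a slope at a
    break point can be read off. *)
Lemma affine_open_closed {R : realType} (a b m c : R) (F : R -> R) :
  a < b -> {within `[a, b], continuous F}%classic ->
  (forall t, a < t < b -> F t = m * t + c) ->
  forall t, a <= t <= b -> F t = m * t + c.
Proof.
move=> ab /continuous_within_itvP-/(_ ab)[_ Fa Fb] Fab.
have cA x : ((m * y + c) @[y --> x] --> m * x + c)%classic.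
  by apply: cvgD; [apply: cvgM; [apply: cvg_cst|apply: cvg_id]|apply: cvg_cst].
have {Fa} Fa : F a = m * a + c.
  apply: (@cvg_unique _ _ (F x @[x --> a^'+])%classic) => //.
  apply: cvg_trans (cvg_at_right_filter (cA a)).
  apply: near_eq_cvg; near=> t; apply/esym/Fab/andP; split; near: t.
    exact: nbhs_right_gt.
  exact: nbhs_right_lt.
have {Fb} Fb : F b = m * b + c.
  apply: (@cvg_unique _ _ (F x @[x --> b^'-])%classic) => //.
  apply: cvg_trans (cvg_at_left_filter (cA b)).
  apply: near_eq_cvg; near=> t; apply/esym/Fab/andP; split; near: t.
    exact: nbhs_left_gt.
  exact: nbhs_left_lt.
move=> t /andP[]; rewrite le_eqVlt => /predU1P[<- _ //|at_].
by rewrite le_eqVlt => /predU1P[->//|tb]; apply: Fab; rewrite at_ tb.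
Unshelve. all: by end_near. Qed.

(** Finitely many break points cannot accumulate at [t]: along [s], the right end is lowered to each
    break point beyond [t]. *)
Lemma free_right_interval {R : realType} (L t : R) (s : seq R) : t < L ->
  exists b, [/\ t < b, b <= L & forall x, x \in s -> ~~ (t < x < b)].
Proof.
move=> tL; elim: s => [|x s [b [tb bL Hb]]]; first by exists L; split.
have [tx|xt] := ltP t x.
  exists (Num.min x b); split; first by rewrite lt_min tx tb.
    by rewrite ge_min bL orbT.
  move=> y; rewrite inE lt_min => /predU1P[->|/Hb]; first by rewrite ltxx !andbF.
  by apply: contra => /and3P[-> _ ->].
exists b; split=> // y; rewrite inE => /predU1P[->|/Hb//].
by rewrite ltNge xt.
Qed.

Lemma free_left_interval {R : realType} (L t : R) (s : seq R) : L < t ->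
  exists b, [/\ L <= b, b < t & forall x, x \in s -> ~~ (b < x < t)].
Proof.
move=> tL; elim: s => [|x s [b [tb bL Hb]]]; first by exists L; split.
have [xt|tx] := ltP x t.
  exists (Num.max x b); split; first by rewrite le_max tb orbT.
    by rewrite gt_max xt bL.
  move=> y; rewrite inE gt_max => /predU1P[->|/Hb]; first by rewrite ltxx.
  by apply: contra => /andP[/andP[_ ->] ->].
exists b; split=> // y; rewrite inE => /predU1P[->|/Hb//].
by rewrite (ltNge x t) tx andbF.
Qed.

Lemma affine_off_right {R : realType} (L t : R) s (F : R -> R) :
  affine_off L s F -> 0 <= t < L ->
  exists2 b, t < b <= L & affine_between t b F.
Proof.
move=> HF /andP[t0 /(@free_right_interval _ _ _ s)[b [tb bL Hb]]].
by exists b; [rewrite tb bL|apply: HF].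
Qed.

Lemma affine_off_left {R : realType} (L t : R) s (F : R -> R) :
  affine_off L s F -> 0 < t <= L ->
  exists2 b, 0 <= b < t & affine_between b t F.
Proof.
move=> HF /andP[/(@free_left_interval _ _ _ s)[b [b0 bt Hb]] tL].
by exists b; [rewrite bt b0|apply: HF].
Qed.

Section Slopes.
Context {R : realType} {G : metrized_graph R}.
Implicit Types (f g : mg_point G -> R) (e : edge G).

Definition along f e : R -> R := fun t => f (edge_point e t).

(** The difference quotient equals [m] for all small positive [h], so the limit exists and [lim]
    takes its genuine value. *)
Lemma slope_fwdE f e (t b m c : R) : t < b ->
  (forall s, t <= s <= b -> along f e s = m * s + c) -> slope_fwd f e t = m.
Proof.
move=> tb H; apply: cvg_lim => //; apply: cvg_near_cst; near=> h.
have h0 : 0 < h by near: h; apply: nbhs_right_gt.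
have hb : h < b - t by near: h; apply: nbhs_right_lt; rewrite subr_gt0.
rewrite -/(along f e _) -/(along f e t) !H; try lra.
by field; lra.
Unshelve. all: by end_near. Qed.

Lemma slope_bwdE f e (t b m c : R) : b < t ->
  (forall s, b <= s <= t -> along f e s = m * s + c) -> slope_bwd f e t = - m.
Proof.
move=> tb H; apply: cvg_lim => //; apply: cvg_near_cst; near=> h.
have h0 : 0 < h by near: h; apply: nbhs_right_gt.
have hb : h < t - b by near: h; apply: nbhs_right_lt; rewrite subr_gt0.
rewrite -/(along f e _) -/(along f e t) !H; try lra.
by field; lra.
Unshelve. all: by end_near. Qed.

Lemma continuous_piecewise_affine_off f e : continuous_piecewise_affine f ->
  exists s, affine_off (len e) s (along f e).
Proof.
move=> /(_ e)[cf [s Hs]]; exists s => a b a0 ab bL sab.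
have [m [c Hmc]] := Hs a b a0 ab bL sab; exists m, c.
apply: affine_open_closed => //; apply: continuous_subspaceW cf.
move=> t /=; rewrite !in_itv /= => /andP[ta tb].
by rewrite (le_trans a0 ta) (le_trans tb bL).
Qed.

(** Continuity is checked on a function [F] defined on the whole line, so neither the subspace
    topology nor the clamping in [edge_point] has to be handled again. *)
Lemma piecewise_affine_intro f :
  (forall e, exists F s, [/\ continuous F, affine_off (len e) s F &
    forall t, 0 <= t <= len e -> along f e t = F t]) ->
  continuous_piecewise_affine f.
Proof.
move=> H e; have [F [s [cF aF fF]]] := H e; split.
  apply: subspace_eq_continuous (continuous_subspaceT cF) => t.
  by rewrite inE /= in_itv /= => /fF/esym.
exists s => a b a0 ab bL /(aF a b a0 ab bL)[m [c Hmc]]; exists m, c => t tab.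
by rewrite -/(along f e t) fF; [apply: Hmc|]; lra.
Qed.

Definition comb f (k : R) g : mg_point G -> R := fun p => f p + k * g p.

Lemma piecewise_affine_comb f k g : continuous_piecewise_affine f ->
  continuous_piecewise_affine g -> continuous_piecewise_affine (comb f k g).
Proof.
move=> Hf Hg e; have [cf [sf af]] := Hf e; have [cg [sg ag]] := Hg e; split.
  move=> t; apply: (@continuousD _ _ _ _ _ t (cf t)).
  by apply: continuousM (cg t); apply: cvg_cst.
exists (sf ++ sg) => a b a0 ab bL H.
have [|m [c Hmc]] := af a b a0 ab bL.
  by move=> t ts; apply: H; rewrite mem_cat ts.
have [|n [d Hnd]] := ag a b a0 ab bL.
  by move=> t ts; apply: H; rewrite mem_cat ts orbT.
by exists (m + k * n), (c + k * d) => t tab; rewrite /comb Hmc // Hnd //; ring.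
Qed.

(** Limits add only when they exist; to the right of [t] both functions are affine on a common
    interval, so all three slopes are coefficients there. *)
Lemma slope_fwd_comb f k g e t : continuous_piecewise_affine f ->
  continuous_piecewise_affine g -> 0 <= t < len e ->
  slope_fwd (comb f k g) e t = slope_fwd f e t + k * slope_fwd g e t.
Proof.
move=> /(@continuous_piecewise_affine_off _ e)[s Hf].
move=> /(@continuous_piecewise_affine_off _ e)[s' Hg] tL.
have [b /andP[tb _] [m [c Hmc]]] := affine_off_right _ _ _ _ Hf tL.
have [b' /andP[tb' _] [n [d Hnd]]] := affine_off_right _ _ _ _ Hg tL.
rewrite (slope_fwdE _ _ _ _ _ _ tb Hmc) (slope_fwdE _ _ _ _ _ _ tb' Hnd).
apply: (@slope_fwdE _ _ t (Num.min b b') _ (c + k * d)).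
  by rewrite lt_min tb tb'.
move=> x; rewrite le_min => /and3P[tx xb xb'].
rewrite /along /comb -/(along f e x) -/(along g e x) Hmc ?tx// Hnd ?tx//; ring.
Qed.

Lemma slope_bwd_comb f k g e t : continuous_piecewise_affine f ->
  continuous_piecewise_affine g -> 0 < t <= len e ->
  slope_bwd (comb f k g) e t = slope_bwd f e t + k * slope_bwd g e t.
Proof.
move=> /(@continuous_piecewise_affine_off _ e)[s Hf].
move=> /(@continuous_piecewise_affine_off _ e)[s' Hg] tL.
have [b /andP[_ tb] [m [c Hmc]]] := affine_off_left _ _ _ _ Hf tL.
have [b' /andP[_ tb'] [n [d Hnd]]] := affine_off_left _ _ _ _ Hg tL.
rewrite (slope_bwdE _ _ _ _ _ _ tb Hmc) (slope_bwdE _ _ _ _ _ _ tb' Hnd).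
rewrite mulrN -opprD.
apply: (@slope_bwdE _ _ t (Num.max b b') _ (c + k * d)).
  by rewrite gt_max tb tb'.
move=> x; rewrite ge_max => /andP[/andP[bx b'x] xt].
rewrite /along /comb -/(along f e x) -/(along g e x) Hmc ?bx// Hnd ?b'x//; ring.
Qed.

Lemma laplacian_comb f k g p : continuous_piecewise_affine f ->
  continuous_piecewise_affine g ->
  laplacian (comb f k g) p = laplacian f p + k * laplacian g p.
Proof.
move=> Hf Hg; rewrite /laplacian mulrN -opprD; congr (- _).
case: p => [v|[[e t] /= te]] /=; last first.
  rewrite slope_fwd_comb ?slope_bwd_comb //; [ring|lra|lra].
rewrite mulrDr !mulr_sumr addrACA -!big_split /=; congr (_ + _).
  by apply: eq_bigr => e _; rewrite slope_fwd_comb // lexx len_gt0.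
by apply: eq_bigr => e _; rewrite slope_bwd_comb // lexx len_gt0.
Qed.

(** * Points of a closed edge *)

Lemma edge_point_src e : edge_point e 0 = inl (src e).
Proof. by rewrite /edge_point insubF ?lexx //= ltxx. Qed.

Lemma edge_point_tgt e : edge_point e (len e) = inl (tgt e).
Proof. by rewrite /edge_point insubF /= ?ltxx ?andbF // leNgt len_gt0. Qed.

Lemma edge_point_interior e t (H : 0 < t < len e) :
  edge_point e t = inr (exist _ (e, t) H).
Proof.
by rewrite /edge_point insubT; congr inr; apply/val_inj.
Qed.

(** Case analysis on a point of a closed edge. The predicate takes parameter and point together, so
    that a formula in [t] can be checked at both ends and in the interior. *)
Lemma edge_point_ind e (P : R -> mg_point G -> Prop) :
  P 0 (inl (src e)) -> P (len e) (inl (tgt e)) ->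
  (forall t (H : 0 < t < len e), P t (inr (exist _ (e, t) H))) ->
  forall t, 0 <= t <= len e -> P t (edge_point e t).
Proof.
move=> P0 P1 Pt t /andP[]; rewrite le_eqVlt => /predU1P[<- _|t0].
  by rewrite edge_point_src.
rewrite le_eqVlt => /predU1P[->|tL]; first by rewrite edge_point_tgt.
have H : 0 < t < len e by rewrite t0 tL.
by rewrite (edge_point_interior _ _ H).
Qed.

End Slopes.

(** * The weighted vertex Laplacian *)

Section VertexLaplacian.
Context {R : realType} {G : metrized_graph R}.
Implicit Types (e : edge G) (u w : vert G -> R) (v : vert G).

Definition grad u e : R := (u (tgt e) - u (src e)) / len e.

(** The sign agrees with [laplacian]: the slope leaving the source of [e] is [grad u e], the one
    leaving its target is the opposite. *)
Definition vlap u v : R :=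
  \sum_(e | tgt e == v) grad u e - \sum_(e | src e == v) grad u e.

(** The Dirichlet form: the integral over the graph of the product of the derivatives of the affine
    interpolations. *)
Definition energy u w : R := \sum_e len e * grad u e * grad w e.

Lemma energyC u w : energy u w = energy w u.
Proof. by apply: eq_bigr => e _; rewrite -mulrA (mulrC (grad u e)) mulrA. Qed.

Lemma sum_fiber (I : finType) (h : I -> vert G) (F : I -> R) w :
  \sum_v w v * (\sum_(e | h e == v) F e) = \sum_e w (h e) * F e.
Proof.
rewrite [RHS](partition_big h xpredT) //=; apply: eq_bigr => v _.
by rewrite mulr_sumr; apply: eq_bigr => e /eqP ->.
Qed.

(** Summation by parts: regrouped by edges, the sum receives from [e] the increment of [w] times
    [grad u e]. *)
Lemma green_vlap u w : \sum_v w v * vlap u v = energy u w.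
Proof.
under eq_bigr do rewrite mulrBr.
rewrite sumrB !sum_fiber -sumrB; apply: eq_bigr => e _.
by rewrite /grad; field; rewrite gt_eqF ?len_gt0.
Qed.

(** All terms are nonnegative, so every gradient vanishes; connectedness then carries the value
    along a path. *)
Lemma energy0_const u : energy u u = 0 -> forall v v', u v = u v'.
Proof.
move=> /eqP; rewrite psumr_eq0 => [/allP H v v'|e _]; last first.
  by rewrite -mulrA mulr_ge0 ?sqr_ge0 // ltW ?len_gt0.
have Du e : u (src e) = u (tgt e).
  have := H e; rewrite mem_index_enum -mulrA mulf_eq0 gt_eqF ?len_gt0 //=.
  rewrite mulf_eq0 orbb mulf_eq0 invr_eq0 (gt_eqF (len_gt0 e)) orbF subr_eq0.
  by move=> /(_ isT) /eqP.
have /connectP[p pP ->] := vert_connected v v'.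
elim: p v pP => //= a p IH v /andP[/existsP[e He] /IH <-].
by case/orP: He => /andP[/eqP <- /eqP <-]; rewrite Du.
Qed.

Lemma harmonic_const u : (forall v, vlap u v = 0) -> forall v v', u v = u v'.
Proof.
move=> Hu; apply: energy0_const; rewrite -green_vlap.
by apply: big1 => v _; rewrite Hu mulr0.
Qed.

Lemma vlap_sum (I : finType) (c : I -> R) (g : I -> vert G -> R) v :
  vlap (fun a => \sum_i c i * g i a) v = \sum_i c i * vlap (g i) v.
Proof.
have D e : grad (fun a => \sum_i c i * g i a) e = \sum_i c i * grad (g i) e.
  rewrite /grad -sumrB mulr_suml; apply: eq_bigr => i _.
  by rewrite -mulrBr mulrA.
rewrite /vlap; under eq_bigr do rewrite D.
under [X in _ - X]eq_bigr do rewrite D.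
rewrite exchange_big [X in _ - X]exchange_big -sumrB; apply: eq_bigr => i _.
by rewrite mulrBr !mulr_sumr.
Qed.

Lemma sum_vlap u : \sum_v vlap u v = 0.
Proof.
have := green_vlap u (fun=> 1); under eq_bigr do rewrite mul1r.
by move=> ->; apply: big1 => e _; rewrite /grad subrr mul0r mulr0.
Qed.

(* Adding the mass u(o) at o makes the vertex Laplacian injective, hence
   surjective; the total mass of the result is u(o), so u(o) = 0. *)
Lemma vlap_solve (o a : vert G) : exists u, u o = 0 /\
  forall v, vlap u v = (v == a)%:R - (v == o)%:R.
Proof.
(* Finite functions into [R^o] form a finite-dimensional vector space, where an injective
   endomorphism is onto. *)
pose M (u : {ffun vert G -> R^o}) : {ffun vert G -> R^o} :=
  [ffun v => vlap u v + (v == o)%:R * u o].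
have M_lin : linear M.
  move=> k u w; apply/ffunP => v; rewrite !ffunE.
  have D e : grad (k *: u + w)%R e = k * grad u e + grad w e.
    by rewrite /grad !ffunE /GRing.scale /=; ring.
  rewrite /vlap; under eq_bigr do rewrite D.
  under [X in _ - X + _]eq_bigr do rewrite D.
  rewrite !big_split /= -!mulr_sumr /GRing.scale /=; ring.
pose ML := GRing.isLinear.Build R {ffun vert G -> R^o} {ffun vert G -> R^o} _
  M M_lin.
pose Ml : {linear {ffun vert G -> R^o} -> {ffun vert G -> R^o}} :=
  HB.pack M ML.
have ker0 : lker (linfun Ml) == 0%VS.
  rewrite -subv0; apply/subvP => u; rewrite memv_ker memv0 lfunE /= => /eqP Mu.
  have Mu0 v : vlap u v + (v == o)%:R * u o = 0.
    by have /ffunP/(_ v) := Mu; rewrite !ffunE.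
  have uo : u o = 0.
    have : \sum_v (vlap u v + (v == o)%:R * u o) = 0 by apply: big1.
    rewrite big_split /= sum_vlap add0r (bigD1 o) //= eqxx mul1r.
    by rewrite big1 ?addr0 // => v /negbTE ->; rewrite mul0r.
  (* Once the added mass vanishes, [u] is harmonic, hence constant with the value [u o = 0]. *)
  have u0 : forall v v', u v = u v'.
    by apply: harmonic_const => v; rewrite -[RHS](Mu0 v) uo mulr0 addr0.
  by apply/eqP/ffunP => v; rewrite (u0 v o) uo ffunE.
have : [ffun v => (v == a)%:R - (v == o)%:R : R^o] \in limg (linfun Ml).
  by rewrite lker0_limgf // memvf.
move=> /memv_imgP[u _]; rewrite lfunE /= => Mu.
have Mu' v : vlap u v + (v == o)%:R * u o = (v == a)%:R - (v == o)%:R.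
  by have /ffunP/(_ v) := Mu; rewrite !ffunE.
have sum_delta b : \sum_v (v == b)%:R = 1 :> R.
  by rewrite (bigD1 b) //= eqxx big1 ?addr0 // => v /negbTE ->.
have uo : u o = 0.
  have : \sum_v (vlap u v + (v == o)%:R * u o)
       = \sum_v ((v == a)%:R - (v == o)%:R) by apply: eq_bigr.
  by rewrite big_split /= sum_vlap sumrB -mulr_suml !sum_delta subrr add0r mul1r.
by exists u; split=> // v; rewrite -Mu' uo mulr0 addr0.
Qed.

(** Since each [g a] vanishes at the root, pairing it with a Laplacian gives the reproducing
    identity [energy (g c) (g d) = g d c]; symmetry of [g] is then symmetry of the energy. *)
Lemma vertex_green : exists (o : vert G) (g : vert G -> vert G -> R),
  (forall a b, g a b = g b a) /\
  forall a v, vlap (g a) v = (v == a)%:R - (v == o)%:R.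
Proof.
have /card_gt0P[root _] := vert_nonempty G.
have [g Hg] := choice (vlap_solve root); exists root, g.
split=> [a b|a v]; last by have [_ ->] := Hg a.
have gE c d : energy (g c) (g d) = g d c.
  have [_ Hc] := Hg c; have [gdo _] := Hg d; rewrite -green_vlap.
  under eq_bigr do rewrite Hc mulrBr.
  have eval x : \sum_v g d v * (v == x)%:R = g d x.
    rewrite (bigD1 x) //= eqxx mulr1 big1 ?addr0 // => v /negbTE ->.
    by rewrite mulr0.
  by rewrite sumrB !eval gdo subr0.
by rewrite -gE energyC gE.
Qed.

End VertexLaplacian.

(** * Potentials on the metrized graph *)

Section Potential.
Context {R : realType} {G : metrized_graph R}.
Implicit Types (f : mg_point G -> R) (e : edge G) (u : vert G -> R).
Implicit Types (p q : mg_point G).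

(* A break point carrying no mass has matching slopes on both sides, so it can
   be removed from the list. *)
Lemma laplacian0_affine f e : continuous_piecewise_affine f ->
  (forall p, laplacian f p = 0) -> affine_between 0 (len e) (along f e).
Proof.
move=> /(@continuous_piecewise_affine_off _ _ _ e)[s Hs] f0.
elim: s Hs => [|x s IH] Hs; first by apply: Hs; rewrite ?lexx ?len_gt0.
apply: IH => a b a0 ab bL sab.
have [xab|xab] := boolP (a < x < b); last first.
  by apply: Hs => // t; rewrite inE => /predU1P[->|/sab].
have /andP[ax xb] := xab.
have [|t|m [c Hmc]] := Hs a x a0 ax; first lra.
  rewrite inE => /predU1P[->|/sab]; first by rewrite ltxx andbF.
  by apply: contra => /andP[-> /lt_trans->].
have [|t|n [d Hnd]] := Hs x b _ xb bL; first lra.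
  rewrite inE => /predU1P[->|/sab]; first by rewrite ltxx.
  by apply: contra => /andP[/(lt_trans ax)-> ->].
have xL : 0 < x < len e by lra.
have := f0 (inr (exist _ (e, x) xL)); rewrite /laplacian /=.
rewrite (slope_fwdE _ _ _ _ _ _ xb Hnd) (slope_bwdE _ _ _ _ _ _ ax Hmc) => nm.
have {nm} nm : n = m by lra.
have := Hmc x; rewrite (Hnd x) ?lexx ?(ltW ax) ?(ltW xb) // nm => /(_ isT) dc.
have {dc} dc : d = c by lra.
exists m, c => t /andP[at_ tb]; have [tx|xt] := leP t x.
  by apply: Hmc; rewrite at_ tx.
by rewrite Hnd ?nm ?dc// (ltW xt) tb.
Qed.

(** As [f] is affine on every edge, its Laplacian at the vertices is [vlap] of its vertex values.
    These are therefore harmonic, hence constant, and interpolation extends this to the edges. *)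
Lemma laplacian0_const f : continuous_piecewise_affine f ->
  (forall p, laplacian f p = 0) -> forall p q, f p = f q.
Proof.
move=> fA f0; pose u v := f (inl v).
have aff e t : 0 <= t <= len e -> along f e t = u (src e) + t * grad u e.
  have L0 := len_gt0 e.
  have [m [c H]] := laplacian0_affine f e fA f0.
  have := H 0; have := H (len e); rewrite /along edge_point_src edge_point_tgt.
  rewrite -/(u _) -/(u _) => H1 H0 tL; rewrite -/(along f e t) H //.
  rewrite /grad H1 ?H0; [field; lra|lra|lra].
have uC : forall v v', u v = u v'.
  apply: harmonic_const => v; rewrite -[RHS](f0 (inl v)) /laplacian /=.
  rewrite opprD addrC /vlap; congr (_ - _); last first.
    apply: eq_bigr => e _; apply/esym.
    apply: (slope_fwdE _ _ _ (len e) _ (u (src e))); first exact: len_gt0.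
    by move=> t /aff ->; ring.
  rewrite -sumrN; apply: eq_bigr => e _.
  apply/esym/eqP; rewrite eqr_oppLR; apply/eqP.
  apply: (slope_bwdE _ _ _ 0 _ (u (src e))); first exact: len_gt0.
  by move=> t /aff ->; ring.
suff H p : exists v, f p = u v.
  by move=> p q; have [v ->] := H p; have [w ->] := H q; apply: uC.
case: p => [v|[[e t] /= te]]; first by exists v.
exists (src e); rewrite -edge_point_interior -/(along f e t) aff; last lra.
by rewrite /grad (uC (tgt e) (src e)) subrr mul0r mulr0 addr0.
Qed.

Lemma voltage_unique (y z : mg_point G) f f' :
  is_voltage z y f -> is_voltage z y f' -> f = f'.
Proof.
move=> [fA fz fD] [f'A f'z f'D]; apply/funext => p.
have := laplacian0_const (comb f (-1) f')
  (piecewise_affine_comb _ _ _ fA f'A).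
move=> /(_ _ p z); rewrite /comb fz f'z => H; apply/eqP; rewrite -subr_eq0.
rewrite -mulN1r H; first by rewrite mulr0 addr0.
by move=> q; rewrite laplacian_comb // fD f'D mulN1r subrr.
Qed.

(* The barycentric weights of a point with respect to the vertices: p and the
   measure with these masses have the same pairing with any function that is
   affine on every edge. *)
Definition weight p (v : vert G) : R :=
  match p with
  | inl a => (v == a)%:R
  | inr q => let: (e, t) := val q in
      (1 - t / len e) * (v == src e)%:R + t / len e * (v == tgt e)%:R
  end.

Definition affine_ext u p : R := \sum_v weight p v * u v.

(* The Green function of the edge containing p and q with grounded ends. *)
Definition tent p q : R :=
  match p, q with
  | inr p', inr q' => let: (e, s) := val p' in let: (e', t) := val q' in
      if e == e' then Num.min s t * (len e - Num.max s t) / len e else 0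
  | _, _ => 0
  end.

(** * Affine extensions of vertex functions *)

Lemma sum_delta u (a : vert G) : \sum_v (v == a)%:R * u v = u a.
Proof.
rewrite (bigD1 a) //= eqxx mul1r big1 ?addr0 // => v /negbTE ->.
by rewrite mul0r.
Qed.

Lemma affine_ext_vert u v : affine_ext u (inl v) = u v.
Proof. exact: sum_delta. Qed.

Lemma affine_ext_along u e t : 0 <= t <= len e ->
  along (affine_ext u) e t = u (src e) + t * grad u e.
Proof.
have L0 := len_gt0 e.
move: t; apply: (edge_point_ind e
  (fun t p => affine_ext u p = u (src e) + t * grad u e)).
- by rewrite affine_ext_vert mul0r addr0.
- by rewrite affine_ext_vert /grad; field; lra.
move=> t te; rewrite /affine_ext /weight /=.
under eq_bigr do rewrite mulrDl -!mulrA.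
by rewrite big_split /= -!mulr_sumr !sum_delta /grad; field; lra.
Qed.

Lemma affine_ext_piecewise u : continuous_piecewise_affine (affine_ext u).
Proof.
apply: piecewise_affine_intro => e.
exists (fun t => u (src e) + t * grad u e), [::]; split.
- move=> t; apply: cvgD; first exact: cvg_cst.
  by apply: cvgM; [apply: cvg_id|apply: cvg_cst].
- by move=> a b _ _ _ _; exists (grad u e), (u (src e)) => t _; ring.
- exact: affine_ext_along.
Qed.

Lemma affine_ext_fwd u e t : 0 <= t < len e ->
  slope_fwd (affine_ext u) e t = grad u e.
Proof.
move=> /andP[t0 tL]; apply: (slope_fwdE _ _ _ (len e) _ (u (src e))) => // s sL.
by rewrite affine_ext_along; [ring|lra].
Qed.

Lemma affine_ext_bwd u e t : 0 < t <= len e ->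
  slope_bwd (affine_ext u) e t = - grad u e.
Proof.
move=> /andP[t0 tL]; apply: (slope_bwdE _ _ _ 0 _ (u (src e))) => // s sL.
by rewrite affine_ext_along; [ring|lra].
Qed.

Lemma laplacian_affine_ext u p : laplacian (affine_ext u) p =
  if p is inl v then vlap u v else 0.
Proof.
case: p => [v|[[e t] /= te]]; rewrite /laplacian /=; last first.
  rewrite affine_ext_fwd ?affine_ext_bwd; [|lra|lra].
  by rewrite subrr oppr0.
rewrite opprD addrC /vlap -sumrN; congr (_ - _); apply: eq_bigr => e _.
  by rewrite affine_ext_bwd ?opprK // lexx len_gt0.
by rewrite affine_ext_fwd // lexx len_gt0.
Qed.

(** * Tent functions and their Laplacian *)

Lemma tent_along_same e s (H : 0 < s < len e) t : 0 <= t <= len e ->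
  along (tent (inr (exist _ (e, s) H))) e t =
  Num.min s t * (len e - Num.max s t) / len e.
Proof.
have /andP[s0 sL] := H; move: t.
apply: (edge_point_ind e (fun t p => tent _ p = _)).
- by rewrite /= (min_idPr _) ?mul0r // ltW.
- by rewrite /= (max_idPr _) ?subrr ?mulr0 ?mul0r // ltW.
- by move=> t te; rewrite /= eqxx.
Qed.

Lemma tent_along_diff e s (H : 0 < s < len e) e' t :
  e != e' -> 0 <= t <= len e' ->
  along (tent (inr (exist _ (e, s) H))) e' t = 0.
Proof.
move=> ee'; move: t; apply: (edge_point_ind e' (fun t p => tent _ p = 0)) => //.
by move=> t te; rewrite /= (negbTE ee').
Qed.

Lemma tent_vert (v : vert G) p : tent (inl v) p = 0.
Proof. by []. Qed.

Lemma tent_piecewise p : continuous_piecewise_affine (tent p).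
Proof.
apply: piecewise_affine_intro => e'.
have zero : continuous (fun _ : R => 0 : R) by move=> t; apply: cvg_cst.
have zeroA : affine_off (len e') [::] (fun _ : R => 0 : R).
  by move=> a b _ _ _ _; exists 0, 0 => t _; ring.
case: p => [v|[[e s] H]]; first by exists (fun=> 0), [::]; split.
have [<-|ee'] := eqVneq e e'; last first.
  by exists (fun=> 0), [::]; split=> // t tL; apply: tent_along_diff.
exists (fun t => Num.min s t * (len e - Num.max s t) / len e), [:: s]; split.
- move=> t; apply: cvgM; last exact: cvg_cst.
  apply: cvgM.
    by apply: (@continuous_min R R (fun=> s) id t); [apply: cvg_cst|apply: cvg_id].
  apply: cvgB; first exact: cvg_cst.
  by apply: (@continuous_max R R (fun=> s) id t); [apply: cvg_cst|apply: cvg_id].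
(* The peak [s] is the only break point: a piece lies either to its right, on the falling branch, or
   to its left, on the rising one. *)
- move=> a b a0 ab bL sab; have [sa|as_] := leP s a.
    exists (- (s / len e)), s => t /andP[at_ _].
    have st : s <= t by apply: le_trans at_.
    rewrite (min_idPl st) (max_idPr st); field; rewrite gt_eqF //.
    exact: len_gt0.
  have bs : b <= s.
    by have := sab s; rewrite mem_head as_ /= -leNgt; apply.
  exists ((len e - s) / len e), 0 => t /andP[_ tb].
  have ts : t <= s by apply: le_trans bs.
  by rewrite (min_idPr ts) (max_idPl ts); field; rewrite gt_eqF // len_gt0.
- exact: tent_along_same.
Qed.

Lemma tent_fwd e s (H : 0 < s < len e) e' t : 0 <= t < len e' ->
  slope_fwd (tent (inr (exist _ (e, s) H))) e' t =
  if e == e' then if t < s then (len e - s) / len e else - (s / len e) else 0.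
Proof.
move=> tL; have [ee'|ee'] := eqVneq e e'; last first.
  apply: (slope_fwdE _ _ _ (len e') _ 0); first lra.
  by move=> x xL; rewrite tent_along_diff //; [ring|lra].
subst e'; have L0 := len_gt0 e; have [ts|st] := ltP t s.
  apply: (slope_fwdE _ _ _ s _ 0) => // x /andP[tx xs].
  rewrite tent_along_same ?(min_idPr xs) ?(max_idPl xs); last lra.
  by field; lra.
apply: (slope_fwdE _ _ _ (len e) _ s); first lra.
move=> x /andP[tx xL]; have sx := le_trans st tx.
rewrite tent_along_same ?(min_idPl sx) ?(max_idPr sx); last lra.
by field; lra.
Qed.

(** At the peak [t = s] the backward direction sees the rising branch and the forward one the
    falling branch; hence [t <= s] here against [t < s] in [tent_fwd]. *)
Lemma tent_bwd e s (H : 0 < s < len e) e' t : 0 < t <= len e' ->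
  slope_bwd (tent (inr (exist _ (e, s) H))) e' t =
  if e == e' then if t <= s then - ((len e - s) / len e) else s / len e else 0.
Proof.
move=> tL; have [ee'|ee'] := eqVneq e e'; last first.
  rewrite -[RHS]oppr0; apply: (slope_bwdE _ _ _ 0 _ 0); first lra.
  by move=> x xL; rewrite tent_along_diff //; [ring|lra].
subst e'; have L0 := len_gt0 e; have [ts|st] := leP t s.
  apply: (slope_bwdE _ _ _ 0 _ 0); first lra.
  move=> x /andP[x0 xt]; have xs := le_trans xt ts.
  rewrite tent_along_same ?(min_idPr xs) ?(max_idPl xs); last lra.
  by field; lra.
rewrite -[RHS]opprK; apply: (slope_bwdE _ _ _ s _ s) => //.
move=> x /andP[sx xt].
rewrite tent_along_same ?(min_idPl sx) ?(max_idPr sx); last lra.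
by field; lra.
Qed.

Lemma sum_at (P : pred (edge G)) (F : edge G -> R) e :
  \sum_(e' | P e') (if e == e' then F e' else 0) = (P e)%:R * F e.
Proof.
rewrite -big_mkcondr /=; have [Pe|Pe] := boolP (P e).
  rewrite (big_pred1 e) ?mul1r // => a /=; rewrite eq_sym.
  by case: eqP => [->|]; rewrite ?Pe ?andbT ?andbF.
rewrite big1 ?mul0r // => a /andP[Pa /eqP ea]; by rewrite ea Pa in Pe.
Qed.

(** The tent sweeps a unit charge from [y] to the ends of its edge. At the peak the two outgoing
    slopes add up to -1, and at the ends they are exactly the barycentric weights of [y]. At a
    vertex nothing is swept. *)
Lemma laplacian_tent y p : laplacian (tent y) p =
  (p == y)%:R - (if p is inl v then weight y v else 0).
Proof.
case: y => [a|[[e s] H]].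
  have E e t : 0 <= t <= len e -> along (tent (inl a)) e t = 0 * t + 0.
    by move=> _; rewrite /along tent_vert mul0r addr0.
  have F e t : 0 <= t < len e -> slope_fwd (tent (inl a)) e t = 0.
    move=> tL; apply: (slope_fwdE _ _ _ (len e) _ 0); first lra.
    by move=> x xL; apply: E; lra.
  have B e t : 0 < t <= len e -> slope_bwd (tent (inl a)) e t = 0.
    move=> tL; rewrite -[RHS]oppr0; apply: (slope_bwdE _ _ _ 0 _ 0); first lra.
    by move=> x xL; apply: E; lra.
  case: p => [v|[[e t] /= te]]; rewrite /laplacian /=; last first.
    by rewrite F ?B; [rewrite addr0 oppr0 addr0|lra|lra].
  have -> : \sum_(e | src e == v) slope_fwd (tent (inl a)) e 0 = 0.
    by apply: big1 => e _; rewrite F // lexx len_gt0.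
  have -> : \sum_(e | tgt e == v) slope_bwd (tent (inl a)) e (len e) = 0.
    by apply: big1 => e _; rewrite B // lexx len_gt0.
  by rewrite addr0 oppr0 subrr.
have L0 := len_gt0 e; case: p => [v|[[e' t] te]]; rewrite /laplacian.
  rewrite /=.
  under eq_bigr => e' _ do rewrite tent_fwd ?lexx ?len_gt0 //.
  under [X in _ + X]eq_bigr => e' _ do rewrite tent_bwd ?lexx ?len_gt0 //.
  rewrite !sum_at !(eq_sym v) (andP H).1 leNgt (andP H).2 /=.
  by field; lra.
have /andP[t0 tL] := te; have /andP[s0 sL] := H.
rewrite /= tent_fwd ?tent_bwd ?t0 ?tL ?(ltW t0) ?(ltW tL) // subr0.
have -> : (inr (exist _ (e', t) te) == inr (exist _ (e, s) H) :> mg_point G)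
    = (e == e') && (t == s).
  apply/eqP/andP => [[-> ->]//|[/eqP ee' /eqP ts]].
  by subst e' s; congr inr; apply/val_inj.
have [_|_] := eqVneq e e'; last by rewrite addr0 oppr0.
(* Away from the peak the two slopes cancel; at [t = s] they leave mass 1. *)
have [ts|st|ts] := ltgtP t s; rewrite /=; field; lra.
Qed.

Lemma weight_along e t : 0 <= t <= len e -> forall u,
  \sum_v weight (edge_point e t) v * u v =
  (1 - t / len e) * u (src e) + t / len e * u (tgt e).
Proof.
move=> tL u; have := affine_ext_along u e t tL; rewrite /along /affine_ext => ->.
by rewrite /grad; field; rewrite gt_eqF ?len_gt0.
Qed.

Lemma sum_weight p : \sum_v weight p v = 1.
Proof.
have E q : \sum_v weight q v = affine_ext (fun=> 1) q.
  by apply: eq_bigr => v _; rewrite mulr1.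
rewrite E; case: p => [v|[[e t] te]]; first by rewrite affine_ext_vert.
rewrite -edge_point_interior -/(along _ e t) affine_ext_along; last first.
  by move: te => /=; lra.
by rewrite /grad subrr mul0r mulr0 addr0.
Qed.

(* The Green function of the whole graph assembled from a Green function g of
   the vertex Laplacian. *)
Definition green (g : vert G -> vert G -> R) p q : R :=
  affine_ext (fun a => \sum_w weight p w * g w a) q + tent p q.

(** The affine part of [green g p] has as Laplacian the swept charge of [p] minus the mass at [o],
    and the tent turns the swept charge back into the point mass at [p]. The pole [o] cancels in the
    difference for [y] and [z]. *)
Lemma voltageE (o : vert G) (g : vert G -> vert G -> R) :
  (forall a v, vlap (g a) v = (v == a)%:R - (v == o)%:R) -> forall z x y,
  voltage z x y = green g y x - green g z x - (green g y z - green g z z).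
Proof.
move=> Hg z x y.
have greenE p : green g p =
    comb (affine_ext (fun a => \sum_w weight p w * g w a)) 1 (tent p).
  by apply/funext => q; rewrite /comb mul1r.
have greenA p : continuous_piecewise_affine (green g p).
  by rewrite greenE; apply: piecewise_affine_comb;
    [apply: affine_ext_piecewise|apply: tent_piecewise].
have greenL p q : laplacian (green g p) q = (q == p)%:R - (q == inl o)%:R.
  rewrite greenE laplacian_comb; [|exact: affine_ext_piecewise|exact: tent_piecewise].
  rewrite laplacian_affine_ext laplacian_tent mul1r.
  case: q => [v|q]; last exact: add0r.
  rewrite vlap_sum; under eq_bigr do rewrite Hg mulrBr.
  rewrite sumrB -mulr_suml sum_weight mul1r.
  under eq_bigr do rewrite eq_sym mulrC.
  rewrite sum_delta.
  have -> : (inl v == inl o :> mg_point G) = (v == o).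
    by apply/eqP/eqP => [[]|->].
  ring.
(* The constant that grounds the difference at [z]; it is subtracted as a multiple of [one] so that
   [laplacian_comb] applies. *)
pose k := green g y z - green g z z.
pose one := affine_ext (fun=> 1).
have oneE p : one p = 1.
  by rewrite /one /affine_ext; under eq_bigr do rewrite mulr1; rewrite sum_weight.
have vlap1 v : vlap (fun=> 1) v = 0 :> R.
  by rewrite /vlap !big1 ?subrr // => e _; rewrite /grad subrr mul0r.
pose f := comb (comb (green g y) (-1) (green g z)) (- k) one.
have oneA : continuous_piecewise_affine one by apply: affine_ext_piecewise.
have fV : is_voltage z y f.
  split.
  - by do 2?[apply: piecewise_affine_comb => //].
  - by rewrite /f /comb oneE /k; ring.
  - move=> p; rewrite /f !laplacian_comb //; last exact: piecewise_affine_comb.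
    rewrite !greenL laplacian_affine_ext.
    by case: p => [v|q]; rewrite ?vlap1; ring.
(* The witness [f] excludes the default value of [xget], and uniqueness identifies the chosen
   potential with [f]. *)
rewrite /voltage; case: xgetP => [f' _ f'V|/(_ f)//].
by rewrite (voltage_unique _ _ _ _ f'V fV) /f /comb oneE /k; ring.
Qed.

(** * The Green function at points of edges *)

Lemma green_edge_edge g e t e' t' :
  0 <= t <= len e -> 0 <= t' <= len e' -> e != e' ->
  green g (edge_point e t) (edge_point e' t') =
  (1 - t' / len e') *
    ((1 - t / len e) * g (src e) (src e') + t / len e * g (tgt e) (src e'))
  + t' / len e' *
    ((1 - t / len e) * g (src e) (tgt e') + t / len e * g (tgt e) (tgt e')).
Proof.
move=> tL tL' ee'; rewrite /green /affine_ext !weight_along //.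
suff -> : tent (edge_point e t) (edge_point e' t') = 0 by rewrite addr0.
apply: (edge_point_ind e (fun t p => tent p _ = 0)) => // s H.
exact: tent_along_diff.
Qed.

(** The last term is the height of the tent, the resistance of the two pieces of the edge in
    parallel. *)
Lemma green_diag g e t : 0 <= t <= len e ->
  green g (edge_point e t) (edge_point e t) =
  (1 - t / len e) *
    ((1 - t / len e) * g (src e) (src e) + t / len e * g (tgt e) (src e))
  + t / len e *
    ((1 - t / len e) * g (src e) (tgt e) + t / len e * g (tgt e) (tgt e))
  + t * (len e - t) / len e.
Proof.
move=> tL; rewrite /green /affine_ext !weight_along //; congr (_ + _).
apply: (edge_point_ind e
  (fun t p => tent p p = t * (len e - t) / len e)) => //.
- by rewrite !mul0r.
- by rewrite subrr mulr0 mul0r.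
- by move=> s H /=; rewrite eqxx minxx maxxx.
Qed.

Lemma green_vert g (a b : vert G) : green g (inl a) (inl b) = g a b.
Proof. by rewrite /green affine_ext_vert sum_delta tent_vert addr0. Qed.

End Potential.

Theorem theorem3p3 (R : realType) (G : metrized_graph R) (ei ej : edge G)
    (hij : ei <> ej) (x y : R)
    (hx : 0 <= x <= len ei) (hy : 0 <= y <= len ej) :
  let r := @resistance R G in
  let j := @voltage R G in
  let Li := len ei in
  let Lj := len ej in
  let p_i : mg_point G := inl (src ei) in
  let q_i : mg_point G := inl (tgt ei) in
  let p_j : mg_point G := inl (src ej) in
  let q_j : mg_point G := inl (tgt ej) in
  r (edge_point ei x) (edge_point ej y) =
    - x ^+ 2 * ((Li - r p_i q_i) / Li ^+ 2)
    - y ^+ 2 * ((Lj - r p_j q_j) / Lj ^+ 2)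
    + (2 * x * y) / (Li * Lj) * (j p_j p_i q_j - j p_j q_i q_j)
    + x / Li * (Li - 2 * j p_i q_i p_j)
    + y / Lj * (Lj - 2 * j p_j p_i q_j)
    + r p_i p_j.
Proof.
have [root [g [gC Hg]]] := @vertex_green R G.
move=> r j Li Lj p_i q_i p_j q_j; rewrite /r /j /resistance !(voltageE root g Hg).
have Li0 : Li != 0 by rewrite gt_eqF ?len_gt0.
have Lj0 : Lj != 0 by rewrite gt_eqF ?len_gt0.
(* Expanding [r(x,y)] produces the Green function at both [(x,y)] and [(y,x)], so the edges must be
   distinguished in either order. *)
have /eqP ne := hij; have ne' : ej != ei by rewrite eq_sym.
rewrite !green_diag // !green_edge_edge // !green_vert -/Li -/Lj.
(* Symmetry leaves one unknown for each unordered pair among the four end points, and a rational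
   identity in these remains. *)
rewrite (gC (tgt ei) (src ei)) (gC (tgt ej) (src ej)) (gC (src ej) (src ei)).
rewrite (gC (src ej) (tgt ei)) (gC (tgt ej) (src ei)) (gC (tgt ej) (tgt ei)).
by field; rewrite Li0 Lj0.
Qed.
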